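(* Let $R_2^{(e)}(x,y,q)$ be the generating function of $r^2$-symmetric parallelogram polyominoes of even width, where $x$, $y$, $q$ mark the width, the height and the area respectively. Then $$R_2^{(e)}(x,y,q)=\frac{1}{1-y}\left(\mathbb{P}\!\left(\tfrac1y,x^2,y^2,q^2\right)-\mathbb{P}\left(1,x^2,y^2,q^2\right)\right),$$ where $\mathbb{P}(v,x,y,q)$ is the generating function of all parallelogram polyominoes, the variables $v$, $x$, $y$, $q$ marking respectively the height of the rightmost column, the width, the overall height and the area.
   Context: A parallelogram polyomino is a finite nonempty connected set of unit cells of the square lattice, considered up to translation, whose intersection with every row and every column of cells is a contiguous block (or empty), and which contains the bottom-left and the top-right cells of its minimal bounding rectangle. Equivalently, with columns numbered $1,\dots,w$ from left to right, column $i$ occupies the rows $b_i,\dots,t_i$ with $b_i\le b_{i+1}\le t_i\le t_{i+1}$ for $1\le i<w$. Width and height are those of the minimal bounding rectangle; the area is the number of cells. Let $r^2$ denote the rotation by $180^\circ$; a polyomino is $r^2$-symmetric if it is equal, up to translation, to its image under $r^2$. Generating functions are formal power series in $q$ whose coefficients are polynomials in the other variables; the substitution $v=1/y$ is understood in formal power series in $q$ with coefficients that are Laurent polynomials in $y$. It is known (Bousquet-Mélou) that $\mathbb{P}(v,x,y,q)=vy\,\dfrac{J_1(v,x,y,q)}{J_0(x,y,q)}$ with $J_0(x,y,q)=\sum_{n\ge0}\frac{(-1)^nx^nq^{\binom{n+1}{2}}}{(q)_n(yq)_n}$ and $J_1(v,x,y,q)=\sum_{n\ge1}\frac{(-1)^{n-1}x^nq^{\binom{n+1}{2}}}{(q)_{n-1}(yq)_{n-1}(1-vyq^n)}$,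 where $(a)_n=\prod_{i=0}^{n-1}(1-aq^i)$. *)

(* Defs.v *)
From mathcomp Require Import all_boot all_order all_algebra fraction.
From mathcomp Require Import finmap.
From mathcomp Require Import boolp classical_sets fsbigop.
From mathcomp Require Import mpoly.

Set Implicit Arguments.
Unset Strict Implicit.
Unset Printing Implicit Defensive.

Import Order.TTheory GRing.Theory Num.Theory.

Local Open Scope fset_scope.
Local Open Scope classical_set_scope.
Local Open Scope ring_scope.

(* The unit cell [i, i+1] x [j, j+1] is encoded by (i, j): first the column,
   numbered from left to right, then the row, numbered from bottom to top. *)
Definition cell : Type := (int * int)%type.

(* Edge adjacency. *)
Definition adjacent : rel cell :=
  fun c d => `|c.1 - d.1| + `|c.2 - d.2| == 1.

Definition connected_cells (S : {fset cell}) : Prop :=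
  forall c d : cell, c \in S -> d \in S ->
    exists s : seq cell,
      [/\ path adjacent c s, all (fun e => e \in S) s & last c s = d].

Definition column_convex (S : {fset cell}) : Prop :=
  forall i j k l : int,
    (i, j) \in S -> (i, l) \in S -> j <= k <= l -> (i, k) \in S.

Definition row_convex (S : {fset cell}) : Prop :=
  forall i j k l : int,
    (i, j) \in S -> (k, j) \in S -> i <= l <= k -> (l, j) \in S.

(* Least and greatest element of a nonempty sequence (0 for the empty one). *)
Definition seq_min (s : seq int) : int := \big[Order.min/head 0 s]_(i <- s) i.
Definition seq_max (s : seq int) : int := \big[Order.max/head 0 s]_(i <- s) i.

(* For nonempty S, the minimal bounding rectangle of S consists of the cells
   (i, j) with xmin S <= i <= xmax S and ymin S <= j <= ymax S. *)
Definition xmin (S : {fset cell}) : int := seq_min [seq c.1 | c <- S].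
Definition xmax (S : {fset cell}) : int := seq_max [seq c.1 | c <- S].
Definition ymin (S : {fset cell}) : int := seq_min [seq c.2 | c <- S].
Definition ymax (S : {fset cell}) : int := seq_max [seq c.2 | c <- S].

Definition parallelogram (S : {fset cell}) : Prop :=
  [/\ S != fset0, connected_cells S, column_convex S /\ row_convex S,
      (xmin S, ymin S) \in S & (xmax S, ymax S) \in S].

Definition width (S : {fset cell}) : nat := `|xmax S - xmin S|.+1.
Definition height (S : {fset cell}) : nat := `|ymax S - ymin S|.+1.
Definition area (S : {fset cell}) : nat := #|` S|.
Definition right_height (S : {fset cell}) : nat :=
  #|` [fset c in S | c.1 == xmax S] |.

Definition translate (u : cell) (S : {fset cell}) : {fset cell} :=
  [fset (c.1 + u.1, c.2 + u.2) | c in S].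

(* Rotation by 180 degrees: it maps the unit square indexed by (i, j) to the
   one indexed by (-1 - i, -1 - j). *)
Definition rot180 (S : {fset cell}) : {fset cell} :=
  [fset (-1 - c.1, -1 - c.2) | c in S].

Definition r2_symmetric (S : {fset cell}) : Prop :=
  exists u : cell, rot180 S = translate u S.

(* Polyominoes are considered up to translation: every translation class has
   exactly one member whose bounding rectangle has (0, 0) as bottom-left
   cell, and only that member is counted. *)
Definition normalized (S : {fset cell}) : Prop := xmin S = 0 /\ ymin S = 0.

(* A formal power series in q is the sequence nat -> A of its coefficients. *)

(* The variables v, x, y of Z[v,x,y]. *)
Definition Pv : {mpoly int[3]} := 'X_(@Ordinal 3 0 isT).
Definition Px : {mpoly int[3]} := 'X_(@Ordinal 3 1 isT).
Definition Py : {mpoly int[3]} := 'X_(@Ordinal 3 2 isT).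

(* Coefficient of q^n in P(v,x,y,q). There are finitely many such S, so that
   the finitely supported sum is the sum over all of them. *)
Definition PP (n : nat) : {mpoly int[3]} :=
  \sum_(S \in [set S : {fset cell} |
                 [/\ parallelogram S, normalized S & area S = n]])
    (Pv ^+ right_height S * Px ^+ width S * Py ^+ height S).

(* The variables x, y of Z[x,y]. *)
Definition Rx : {mpoly int[2]} := 'X_(@Ordinal 2 0 isT).
Definition Ry : {mpoly int[2]} := 'X_(@Ordinal 2 1 isT).

(* Coefficient of q^n in the generating function of r^2-symmetric
   parallelogram polyominoes of even width. *)
Definition R2e (n : nat) : {mpoly int[2]} :=
  \sum_(S \in [set S : {fset cell} |
                 [/\ parallelogram S, normalized S & area S = n]
                 /\ (r2_symmetric S /\ ~~ odd (width S))])
    (Rx ^+ width S * Ry ^+ height S).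

(* The field Q(x,y). It contains the ring of Laurent polynomials in y over
   Z[x], in which 1/y is substituted for v, and 1/(1-y) makes sense in it. *)
Definition Qxy : fieldType := {fraction {mpoly int[2]}}.
Definition Qxy_of (p : {mpoly int[2]}) : Qxy := tofrac p.
Definition x_ : Qxy := Qxy_of Rx.
Definition y_ : Qxy := Qxy_of Ry.

(* The series F(q^2). *)
Definition subst_q2 (A : zmodType) (F : nat -> A) : nat -> A :=
  fun n => if odd n then 0 else F n./2.

(* The series P(a,b,c,q) with a, b, c substituted for v, x, y. *)
Definition PP_at (a b c : Qxy) : nat -> Qxy :=
  fun n => mmap intr (tnth [tuple a; b; c]) (PP n).

(* Main.v *)
Require Import Defs.
From mathcomp Require Import all_boot all_order all_algebra fraction.
From mathcomp Require Import finmap boolp classical_sets cardinality fsbigop.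
From mathcomp Require Import mpoly zify ring.

(** Cut an r^2-symmetric parallelogram polyomino S of even width 2w along its
    vertical middle line.  The left half Q is a parallelogram polyomino of
    width w, and the right half is the image of Q under the half-turn of the
    bounding rectangle of S; so S is determined by Q and by the number k of
    rows shared by the two middle columns.  These columns have the same height
    h, the height of the rightmost column of Q, and the inequalities between
    consecutive columns say exactly that 1 <= k <= h.  Conversely every such
    pair (Q, k) glues to a symmetric polyomino, of width 2w, height 2H - k and
    area 2a, where H and a are the height and the area of Q.  Hence
      R = sum over Q of x^(2w) q^(2a) (y^(2H-1) + ... + y^(2H-h)),
    and the inner geometric sum is (y^(-h) - 1) y^(2H) / (1 - y), which is the
    right-hand side of the theorem, term by term in Q.

    The geometry rests on the description of a polyomino by the bottoms and
    tops of its columns: [parallelogram_column_form] and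
    [column_form_parallelogram] pass from the cell-by-cell definition to that
    description and back.  The bijection is [glue] with inverse [left_half]
    ([left_half_glue], [glue_left_half]); it is summed up in
    [symmetric_even_enum]. *)

Import Order.TTheory GRing.Theory Num.Theory.
Local Open Scope fset_scope.
Local Open Scope ring_scope.

Set Implicit Arguments.
Unset Strict Implicit.
Unset Printing Implicit Defensive.

(** * Extrema of sequences of integers *)

Lemma bigmin_mem (x : int) s : \big[Order.min/x]_(i <- s) i \in x :: s.
Proof.
elim: s => [|y s IHs]; first by rewrite big_nil mem_head.
rewrite big_cons minElt; case: ifP => _; first by rewrite !inE eqxx orbT.
by move: IHs; rewrite !inE => /orP[-> //|->]; rewrite !orbT.
Qed.

Lemma bigmax_mem (x : int) s : \big[Order.max/x]_(i <- s) i \in x :: s.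
Proof.
elim: s => [|y s IHs]; first by rewrite big_nil mem_head.
rewrite big_cons maxElt; case: ifP => _; last by rewrite !inE eqxx orbT.
by move: IHs; rewrite !inE => /orP[-> //|->]; rewrite !orbT.
Qed.

Lemma seq_min_mem s : s != [::] -> seq_min s \in s.
Proof.
case: s => [//|x s] _; rewrite /seq_min /=.
have := bigmin_mem x (x :: s).
by rewrite in_cons => /orP[/eqP->|//]; rewrite mem_head.
Qed.

Lemma seq_max_mem s : s != [::] -> seq_max s \in s.
Proof.
case: s => [//|x s] _; rewrite /seq_max /=.
have := bigmax_mem x (x :: s).
by rewrite in_cons => /orP[/eqP->|//]; rewrite mem_head.
Qed.

Lemma seq_min_le s x : x \in s -> seq_min s <= x.
Proof.
rewrite /seq_min; elim: s (head 0 s) => [//|y s IHs] z.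
by rewrite in_cons big_cons ge_min => /orP[/eqP->|/IHs->]; rewrite ?lexx ?orbT.
Qed.

Lemma seq_max_ge s x : x \in s -> x <= seq_max s.
Proof.
rewrite /seq_max; elim: s (head 0 s) => [//|y s IHs] z.
by rewrite in_cons big_cons le_max => /orP[/eqP->|/IHs->]; rewrite ?lexx ?orbT.
Qed.

Lemma seq_min_unique s x :
  x \in s -> (forall y, y \in s -> x <= y) -> seq_min s = x.
Proof.
move=> xs minx; apply/le_anti; rewrite seq_min_le // minx // seq_min_mem //.
by apply: contraTneq xs => ->.
Qed.

Lemma seq_max_unique s x :
  x \in s -> (forall y, y \in s -> y <= x) -> seq_max s = x.
Proof.
move=> xs maxx; apply/le_anti; rewrite seq_max_ge // maxx // seq_max_mem //.
by apply: contraTneq xs => ->.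
Qed.

(** * From cells to columns *)

(** The values of [b] and [t] matter only on [0 <= i < w].  The requirement
    [b 0 = 0] and the numbering of the columns from 0 put the bottom-left cell
    of the bounding rectangle at the origin. *)
Definition column_form (S : {fset cell}) (w : int) (b t : int -> int) : Prop :=
  [/\ 0 < w, b 0 = 0,
      forall i j : int, ((i, j) \in S) = [&& 0 <= i, i < w, b i <= j & j <= t i],
      forall i : int, 0 <= i < w -> b i <= t i
    & forall i : int, 0 <= i -> i + 1 < w ->
        [/\ b i <= b (i + 1), b (i + 1) <= t i & t i <= t (i + 1)]].

(** Connectedness makes neighbouring columns touch: a path going from the left
    to the right of the line between columns i and i + 1 has a horizontal step
    across that line. *)
Lemma path_crosses_column (S : {fset cell}) c s (i : int) :
  path adjacent c s -> all (fun e => e \in S) s -> c \in S ->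
  c.1 <= i -> i < (last c s).1 -> exists j, (i, j) \in S /\ (i + 1, j) \in S.
Proof.
elim: s c => [|e s IHs] c /=; first by move=> _ _ _; lia.
move=> /andP[ce es] /andP[eS sS] cS ci; have [ei|ie] := leP e.1 i.
  exact: IHs.
move=> _; exists c.2; case: c e ce eS cS ci ie {es IHs} => [c1 c2] [e1 e2].
rewrite /adjacent /= => ce eS cS ci ie.
have -> : i = c1 by lia.
by split=> //; move: eS; congr (_ \in S); congr pair; lia.
Qed.

(** If the bottom dropped from column i to column i + 1, the row of the new
    bottom would also meet some column before i, because the bottoms start
    from their minimum and neighbouring columns touch; row convexity would then
    put a cell below the bottom of column i.  Stated for arbitrary functions,
    so that it yields the monotonicity of the tops as well, by a half-turn. *)
Lemma bottoms_nondecreasing (w : int) (b t : int -> int) :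
  (forall i : int, 0 <= i -> i + 1 < w -> b (i + 1) <= t i) ->
  (forall i : int, 0 <= i < w -> b i <= t i) ->
  (forall i j k l : int, 0 <= i -> k < w -> b i <= j <= t i -> b k <= j <= t k ->
     i <= l <= k -> b l <= j) ->
  (forall i : int, 0 <= i < w -> b 0 <= b i) ->
  forall i : int, 0 <= i -> i + 1 < w -> b i <= b (i + 1).
Proof.
move=> touch nonempty rowc b0_min i i0 iw; rewrite leNgt; apply/negP => drop.
(* The last column before n whose bottom is at most j still reaches row j,
   since the next bottom is above j and touches it. *)
have left_cell (n : nat) (j : int) : (n%:Z < w) -> b 0 <= j < b n ->
    exists2 m : nat, (m < n)%N & b m <= j <= t m.
  elim: n => [|n IHn] nw; first by case/andP=> h; rewrite ltNge h.
  have [jn|nj] := ltP j (b n).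
    move=> ?; have [||m mn mj] := IHn; try lia.
    by exists m => //; apply: ltnW.
  move=> jb; exists n => //; have := touch n.
  have -> : n%:Z + 1 = n.+1%:Z by lia.
  by lia.
have [||m mi mj] := left_cell `|i|%N (b (i + 1)); first by lia.
  have -> : `|i|%N%:Z = i by lia.
  by rewrite drop b0_min //; lia.
have := rowc m (b (i + 1)) (i + 1) i.
have := nonempty (i + 1).
lia.
Qed.

Section Columns.
Variable S : {fset cell}.
Let col (i : int) := [fset c in S | c.1 == i].

Lemma col_bounds i j : (i, j) \in S -> ymin (col i) <= j <= ymax (col i).
Proof.
move=> ijS; have jc : j \in [seq c.2 | c <- col i].
  by apply/mapP; exists (i, j); rewrite // !inE /= ijS eqxx.
by rewrite seq_min_le ?seq_max_ge.
Qed.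

Lemma col_ymin_mem i j : (i, j) \in S -> (i, ymin (col i)) \in S.
Proof.
move=> ijS; have : [seq c.2 | c <- col i] != [::].
  have : (i, j) \in col i by rewrite !inE /= ijS eqxx.
  by move=> h; apply: contraTneq (map_f snd h) => ->.
move=> /seq_min_mem/mapP[[k l]]; rewrite !inE /= => /andP[klS /eqP ki] eq_l.
by rewrite /ymin eq_l -ki.
Qed.

Lemma col_ymax_mem i j : (i, j) \in S -> (i, ymax (col i)) \in S.
Proof.
move=> ijS; have : [seq c.2 | c <- col i] != [::].
  have : (i, j) \in col i by rewrite !inE /= ijS eqxx.
  by move=> h; apply: contraTneq (map_f snd h) => ->.
move=> /seq_max_mem/mapP[[k l]]; rewrite !inE /= => /andP[klS /eqP ki] eq_l.
by rewrite /ymax eq_l -ki.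
Qed.

Lemma parallelogram_column_form :
  parallelogram S -> normalized S -> exists w b t, column_form S w b t.
Proof.
move=> [S0 conn [colc rowc] bl tr] [x0 y0]; rewrite x0 y0 in bl.
pose b (i : int) : int := ymin (col i); pose t (i : int) : int := ymax (col i).
have inx (i j : int) : (i, j) \in S -> 0 <= i <= xmax S.
  move=> h; rewrite -{1}x0 seq_min_le ?seq_max_ge //; exact: (map_f fst h).
have iny (i j : int) : (i, j) \in S -> 0 <= j <= ymax S.
  move=> h; rewrite -{1}y0 seq_min_le ?seq_max_ge //; exact: (map_f snd h).
have cross (i : int) : 0 <= i -> i + 1 < xmax S + 1 ->
    exists j, (i, j) \in S /\ (i + 1, j) \in S.
  move=> i0 iw; have [s [ps ss ls]] := conn _ _ bl tr.
  by apply: path_crosses_column ps ss bl _ _; rewrite ?ls /=; lia.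
have nonempty (i : int) : 0 <= i < xmax S + 1 -> exists j, (i, j) \in S.
  move=> iw; have [ei|ni] := eqVneq i (xmax S).
    by exists (ymax S); rewrite ei.
  by have [||j []] := cross i; try lia; exists j.
have bS (i : int) : 0 <= i < xmax S + 1 -> (i, b i) \in S.
  by move=> /nonempty[j]; apply: col_ymin_mem.
have tS (i : int) : 0 <= i < xmax S + 1 -> (i, t i) \in S.
  by move=> /nonempty[j]; apply: col_ymax_mem.
have bt (i : int) : 0 <= i < xmax S + 1 -> b i <= t i.
  by move=> /bS/col_bounds; rewrite -/(b i) -/(t i); lia.
have inS (i j : int) : 0 <= i < xmax S + 1 -> b i <= j <= t i -> (i, j) \in S.
  by move=> iw; apply: colc; [apply: bS|apply: tS].
have Sin (i j : int) : (i, j) \in S -> b i <= j <= t i by apply: col_bounds.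
have touch (i : int) : 0 <= i -> i + 1 < xmax S + 1 -> b (i + 1) <= t i /\ b i <= t (i + 1).
  by move=> i0 iw; have [j [/Sin hj /Sin hj']] := cross i i0 iw; lia.
have rowb (i j k l : int) : 0 <= i -> k < xmax S + 1 -> b i <= j <= t i -> b k <= j <= t k ->
     i <= l <= k -> b l <= j <= t l.
  by move=> i0 kw ij kj il; apply/Sin/(rowc i j k l) => //; apply: inS => //; lia.
have w0 : 0 <= xmax S by have := inx _ _ bl; lia.
have b00 : b 0 = 0.
  have h : (0 : int) <= 0 < xmax S + 1 by lia.
  by have := iny _ _ (bS _ h); have := Sin _ _ bl; lia.
exists (xmax S + 1), b, t; split=> //; first by lia.
  move=> i j; apply/idP/idP => [h|h]; last by apply: inS; lia.
  by have := inx _ _ h; have := Sin _ _ h; lia.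
move=> i i0 iw; have [bti _] := touch i i0 iw; split=> //.
  apply: (@bottoms_nondecreasing (xmax S + 1) b t) => //.
  - by move=> k k0 kw; have [] := touch k k0 kw.
  - by move=> i' j k l *; have := rowb i' j k l; lia.
  - by move=> k /bS/iny; lia.
(* Tops of S are bottoms of its image under a half-turn. *)
pose r (k : int) := xmax S - k.
have := @bottoms_nondecreasing (xmax S + 1) (fun k => - t (r k)) (fun k => - b (r k)).
rewrite /r => /(_ _ _ _ _ (xmax S - i - 1)).
have -> : xmax S - (xmax S - i - 1 + 1) = i by lia.
have -> : xmax S - (xmax S - i - 1) = i + 1 by lia.
move=> h; rewrite -lerN2; apply: h; try lia.
- move=> k k0 kw; have := touch (xmax S - (k + 1)).
  have -> : xmax S - (k + 1) + 1 = xmax S - k by lia.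
  by lia.
- by move=> k kw; have := bt (xmax S - k); lia.
- move=> i' j k l *.
  by have := rowb (xmax S - k) (- j) (xmax S - i') (xmax S - l); lia.
- move=> k kw; rewrite subr0.
  have hk : 0 <= xmax S - k < xmax S + 1 by lia.
  have := iny _ _ (tS _ hk); have := Sin _ _ tr; lia.
Qed.
End Columns.

(** * From columns to cells *)

Lemma nondecreasing_le (w : int) (f : int -> int) :
  (forall i : int, 0 <= i -> i + 1 < w -> f i <= f (i + 1)) ->
  forall i k : int, 0 <= i <= k -> k < w -> f i <= f k.
Proof.
move=> step i k ik kw; have -> : k = i + `|k - i|%N by lia.
have : i + `|k - i|%N < w by lia.
elim: (`|k - i|)%N => [|n IHn] nw; first by rewrite addr0.
apply: le_trans (IHn _) _; first by lia.
have -> : i + n.+1%:Z = i + n%:Z + 1 by lia.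
by apply: step; lia.
Qed.

Definition connected_to (S : {fset cell}) (c d : cell) : Prop :=
  exists s, [/\ path adjacent c s, all (fun e => e \in S) s & last c s = d].

Lemma connected_to_trans S c d e :
  connected_to S c d -> connected_to S d e -> connected_to S c e.
Proof.
move=> [s [ps ss ls]] [r [pr sr lr]]; exists (s ++ r).
by rewrite cat_path all_cat last_cat ls ps ss pr sr.
Qed.

Lemma connected_to_step S c d : adjacent c d -> d \in S -> connected_to S c d.
Proof. by move=> cd dS; exists [:: d]; rewrite /= cd dS. Qed.

Lemma connected_to_sym S c d : c \in S -> connected_to S c d -> connected_to S d c.
Proof.
move=> cS [s []]; elim: s c cS => [|e s IHs] c cS /=.
  by move=> _ _ <-; exists [::].
move=> /andP[ce es] /andP[eS sS] ls.
apply: connected_to_trans (IHs e eS es sS ls) (connected_to_step _ cS).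
by rewrite /adjacent distrC [X in _ + X]distrC.
Qed.

Section ColumnForm.
Variables (S : {fset cell}) (w : int) (b t : int -> int).
Hypothesis cf : column_form S w b t.

Let w_gt0 : 0 < w. Proof. by case: cf. Qed.
Let b0 : b 0 = 0. Proof. by case: cf. Qed.
Let memS (i j : int) : ((i, j) \in S) = [&& 0 <= i, i < w, b i <= j & j <= t i].
Proof. by case: cf. Qed.
Let bt (i : int) : 0 <= i < w -> b i <= t i.
Proof. by case: cf => _ _ _ h _; apply: h. Qed.

Lemma bottom_le_next (i : int) : 0 <= i -> i + 1 < w -> b i <= b (i + 1).
Proof. by case: cf => _ _ _ _ h i0 iw; have [] := h i i0 iw. Qed.

Lemma next_bottom_le_top (i : int) : 0 <= i -> i + 1 < w -> b (i + 1) <= t i.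
Proof. by case: cf => _ _ _ _ h i0 iw; have [] := h i i0 iw. Qed.

Lemma top_le_next (i : int) : 0 <= i -> i + 1 < w -> t i <= t (i + 1).
Proof. by case: cf => _ _ _ _ h i0 iw; have [] := h i i0 iw. Qed.

Lemma bottom_le (i k : int) : 0 <= i <= k -> k < w -> b i <= b k.
Proof. exact/nondecreasing_le/bottom_le_next. Qed.

Lemma top_le (i k : int) : 0 <= i <= k -> k < w -> t i <= t k.
Proof. exact/nondecreasing_le/top_le_next. Qed.

Lemma column_form_origin : (0, 0) \in S.
Proof. by rewrite memS b0; have := @bt 0; lia. Qed.

Lemma column_form_corner : (w - 1, t (w - 1)) \in S.
Proof. by rewrite memS; have := @bt (w - 1); lia. Qed.

Lemma column_form_box (i j : int) : (i, j) \in S -> 0 <= j <= t (w - 1).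
Proof.
rewrite memS => h; have := @bottom_le 0 i; have := @top_le i (w - 1).
by rewrite b0; lia.
Qed.

Lemma column_form_xmin : xmin S = 0.
Proof.
apply: seq_min_unique; first exact: (map_f fst column_form_origin).
by move=> _ /mapP[[i j] + ->]; rewrite memS /=; lia.
Qed.

Lemma column_form_ymin : ymin S = 0.
Proof.
apply: seq_min_unique; first exact: (map_f snd column_form_origin).
by move=> _ /mapP[[i j] + ->] => /column_form_box /=; lia.
Qed.

Lemma column_form_xmax : xmax S = w - 1.
Proof.
apply: seq_max_unique; first exact: (map_f fst column_form_corner).
by move=> _ /mapP[[i j] + ->]; rewrite memS /=; lia.
Qed.

Lemma column_form_ymax : ymax S = t (w - 1).
Proof.
apply: seq_max_unique; first exact: (map_f snd column_form_corner).
by move=> _ /mapP[[i j] + ->] => /column_form_box /=; lia.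
Qed.

Lemma column_form_normalized : normalized S.
Proof. by split; [apply: column_form_xmin|apply: column_form_ymin]. Qed.

Lemma column_form_width : width S = w :> int.
Proof. by rewrite /width column_form_xmin column_form_xmax; lia. Qed.

Lemma column_form_height : height S = t (w - 1) + 1 :> int.
Proof.
rewrite /height column_form_ymin column_form_ymax.
by have := column_form_box column_form_corner; lia.
Qed.

Lemma column_form_right_height :
  right_height S = t (w - 1) - b (w - 1) + 1 :> int.
Proof.
rewrite /right_height column_form_xmax.
pose h := absz (t (w - 1) - b (w - 1) + 1); pose s := iota 0 h.
have -> : [fset c in S | c.1 == w - 1] =
    [fset ((w - 1, b (w - 1) + n%:Z) : cell) | n in s].
  apply/fsetP=> -[i j]; apply/idP/idP.
    rewrite !inE memS /= => /andP[ijS /eqP iw]; apply/imfsetP.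
    exists `|j - b (w - 1)|%N; rewrite /= ?mem_iota; rewrite iw in ijS *.
      by rewrite /h; lia.
    by congr pair; lia.
  case/imfsetP => n; rewrite /= mem_iota => nh [-> ->].
  by rewrite !inE memS /=; have := @bt (w - 1); rewrite /h in nh; lia.
rewrite card_imfset /=; last by move=> m n []; lia.
by rewrite undup_id ?iota_uniq ?size_iota /h; have := @bt (w - 1); lia.
Qed.

Lemma right_height_le : (right_height S <= height S)%N.
Proof.
have := column_form_right_height; have := column_form_height.
by have := @bottom_le 0 (w - 1); rewrite b0; lia.
Qed.

(** Every cell is reached from the origin along the bottoms of the columns:
    up in column i - 1 to the bottom of column i, which is at most the top of
    column i - 1, then one step to the right. *)
Lemma connected_to_origin (i j : int) : (i, j) \in S -> connected_to S (0, 0) (i, j).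
Proof.
have up (n : nat) (k l : int) : (k, l) \in S -> (k, l + n) \in S ->
    connected_to S (k, l) (k, l + n).
  elim: n => [|n IHn] kl kln; first by rewrite addr0; exists [::].
  apply: (@connected_to_trans _ _ (k, l + n)).
    by apply: IHn => //; rewrite !memS in kl kln *; lia.
  by apply: connected_to_step => //; rewrite /adjacent /=; lia.
have up_to (k l m : int) : (k, l) \in S -> (k, m) \in S -> l <= m ->
    connected_to S (k, l) (k, m).
  move=> kl km lm; have e : m = l + `|m - l|%N by lia.
  by rewrite e; apply: up => //; rewrite -e.
have bottom (n : nat) : (n%:Z, b n) \in S -> connected_to S (0, 0) (n%:Z, b n).
  elim: n => [|n IHn] nS; first by rewrite b0; exists [::].
  have e : n.+1%:Z = n%:Z + 1 by lia.
  rewrite e in nS *.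
  have nb : (n%:Z, b n) \in S by move: nS; rewrite !memS; have := @bt n; lia.
  have nb' : (n%:Z, b (n%:Z + 1)) \in S.
    move: nS; rewrite !memS.
    by have := @bottom_le_next n; have := @next_bottom_le_top n; lia.
  apply: connected_to_trans (IHn nb) _; apply: connected_to_trans (up_to _ _ _ nb nb' _) _.
    by apply: bottom_le_next; move: nS; rewrite memS; lia.
  by apply: connected_to_step => //; rewrite /adjacent /=; lia.
move=> ijS; have e : i = `|i|%N by move: ijS; rewrite memS; lia.
have bS : (i, b i) \in S by move: ijS; rewrite !memS; lia.
apply: connected_to_trans (up_to _ _ _ bS ijS _); last by move: ijS; rewrite memS; lia.
by rewrite e; apply: bottom; rewrite -e.
Qed.

Lemma column_form_parallelogram : parallelogram S.
Proof.
split.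
- by apply/fset0Pn; exists (0, 0); apply: column_form_origin.
- move=> [i j] [k l] /connected_to_origin ij /connected_to_origin kl.
  exact: connected_to_trans (connected_to_sym column_form_origin ij) kl.
- split=> [i j k l|i j k l]; rewrite !memS; first by lia.
  move=> ij kj il; have := @bottom_le l k; have := @top_le i l; lia.
- by rewrite column_form_xmin column_form_ymin column_form_origin.
- by rewrite column_form_xmax column_form_ymax column_form_corner.
Qed.

(** The first column whose top is at least j starts at most at the previous
    top, hence below j. *)
Lemma row_nonempty (j : int) : 0 <= j <= t (w - 1) -> exists i, (i, j) \in S.
Proof.
have row (n : nat) : n%:Z < w -> 0 <= j <= t n -> exists i, (i, j) \in S.
  elim: n => [|n IHn] nw jn; first by exists 0; rewrite memS b0 lexx w_gt0.
  have [jt|tj] := leP j (t n); first by apply: IHn; lia.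
  exists n.+1%:Z; rewrite memS; have := @next_bottom_le_top n.
  have -> : n%:Z + 1 = n.+1%:Z by lia.
  by lia.
have e : w - 1 = `|w - 1|%N by lia.
by rewrite e; apply: row; lia.
Qed.

(** Together with the bound on the height, this confines the polyominoes of
    area n to a square of side n, so that there are finitely many of them. *)
Lemma width_le_area : (width S <= area S)%N.
Proof.
rewrite -[width S](size_iota 0) -(size_map Posz) /area -(size_map fst).
apply: uniq_leq_size; first by rewrite map_inj_uniq ?iota_uniq // => m n [].
move=> _ /mapP[n + ->]; rewrite mem_iota => nw; apply/mapP.
exists (n%:Z, b n) => //; rewrite memS; have := column_form_width; have := @bt n.
lia.
Qed.

Lemma height_le_area : (height S <= area S)%N.
Proof.
rewrite -[height S](size_iota 0) -(size_map Posz) /area -(size_map snd).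
apply: uniq_leq_size; first by rewrite map_inj_uniq ?iota_uniq // => m n [].
move=> _ /mapP[n + ->]; rewrite mem_iota => nw; apply/mapP.
have [|i inS] := @row_nonempty n; last by exists (i, n%:Z).
by have := column_form_height; lia.
Qed.

(** The translation in the definition of symmetry is forced: the rotated set
    must have the same bounding rectangle after translation, so the symmetry
    is the half-turn about the centre of that rectangle. *)
Lemma r2_symmetricP :
  r2_symmetric S <->
  forall i j : int, (i, j) \in S -> (w - 1 - i, t (w - 1) - j) \in S.
Proof.
split=> [[u symS]|turnS].
  have turn (i j : int) : (i, j) \in S -> (- 1 - i - u.1, - 1 - j - u.2) \in S.
    move=> ijS; have : (- 1 - i, - 1 - j) \in rot180 S.
      by apply/imfsetP; exists (i, j).
    rewrite symS => /imfsetP[[k l] /= klS [-> ->]].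
    by rewrite !addrK.
  move=> i j /turn.
  (* The images of two opposite corners pin down the translation. *)
  have := turn _ _ column_form_origin; have := turn _ _ column_form_corner.
  move=> h1 h2; have h3 := column_form_box h1; have h4 := column_form_box h2.
  rewrite !memS in h1 h2.
  by congr (_ \in S); congr pair; lia.
exists (- w, - 1 - t (w - 1)); apply/fsetP=> -[i j]; apply/idP/idP.
  case/imfsetP=> -[k l] /= klS [-> ->]; apply/imfsetP; exists (w - 1 - k, t (w - 1) - l).
    exact: turnS.
  by congr pair => /=; lia.
case/imfsetP=> -[k l] /= klS [-> ->]; apply/imfsetP; exists (w - 1 - k, t (w - 1) - l).
  exact: turnS.
by congr pair => /=; lia.
Qed.

End ColumnForm.

(** * Gluing a polyomino to its half-turn *)

(** The half-turn of the rectangle with W columns and H rows whose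
    bottom-left cell is (0, 0). *)
Definition half_turn (W H : int) (c : cell) : cell := (W - 1 - c.1, H - 1 - c.2).

Lemma half_turnK W H : involutive (half_turn W H).
Proof. by case=> i j; rewrite /half_turn /=; congr pair; lia. Qed.

(** The bounding rectangle of the result has height 2H - k when the rightmost
    column of Q and its rotated copy share k rows. *)
Definition glue (Q : {fset cell}) (k : nat) : {fset cell} :=
  Q `|` [fset half_turn (2 * (width Q)%:Z) (2 * (height Q)%:Z - k%:Z) c | c in Q].

Definition left_half (S : {fset cell}) : {fset cell} :=
  [fset c in S | c.1 < (width S)./2%:Z].

Lemma mem_glue Q k c :
  (c \in glue Q k) =
  (c \in Q) || (half_turn (2 * (width Q)%:Z) (2 * (height Q)%:Z - k%:Z) c \in Q).
Proof.
rewrite inE; congr orb; apply/imfsetP/idP => [[d dQ ->]|cQ].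
  by rewrite half_turnK.
by eexists; [exact: cQ|rewrite half_turnK].
Qed.

Lemma mem_left_half S c :
  (c \in left_half S) = (c \in S) && (c.1 < (width S)./2%:Z).
Proof. by rewrite !inE. Qed.

Section Glue.
Variables (Q : {fset cell}) (w : int) (b t : int -> int) (k : nat).
Hypotheses (cf : column_form Q w b t) (k_bounds : (0 < k <= right_height Q)%N).

Let k_le : 1 <= k%:Z <= t (w - 1) - b (w - 1) + 1.
Proof. by have := column_form_right_height cf; lia. Qed.

Let H' : int := 2 * t (w - 1) + 2 - k%:Z.
Let b' (i : int) : int := if i < w then b i else H' - 1 - t (2 * w - 1 - i).
Let t' (i : int) : int := if i < w then t i else H' - 1 - b (2 * w - 1 - i).

Let mem_glue_cf (i j : int) :
  ((i, j) \in glue Q k) =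
  ((i, j) \in Q) || ((2 * w - 1 - i, H' - 1 - j) \in Q).
Proof.
rewrite mem_glue /half_turn /= (column_form_width cf) (column_form_height cf).
by congr (_ || (_ \in Q)); congr pair; rewrite /H'; lia.
Qed.

(** Only the middle pair of columns uses the bounds on k: the column
    [b(w-1), t(w-1)] is followed by its translate by t(w-1) - b(w-1) + 1 - k,
    which must be nonnegative and at most t(w-1) - b(w-1). *)
Lemma glue_column_form : column_form (glue Q k) (2 * w) b' t'.
Proof.
have [w0 b0 memQ bt step] := cf; split.
- by lia.
- by rewrite /b' w0.
- move=> i j; rewrite mem_glue_cf !memQ /b' /t'.
  by have [iw|wi] := ltP i w; lia.
- move=> i iw; rewrite /b' /t'; have [iw'|wi] := ltP i w; first by apply: bt; lia.
  by have := bt (2 * w - 1 - i); lia.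
move=> i i0 iw; rewrite /b' /t'; have [iw'|wi] := ltP i w.
  have [iw1|wi1] := ltP (i + 1) w; first exact: step.
  have -> : 2 * w - 1 - (i + 1) = w - 1 by lia.
  have -> : i = w - 1 by lia.
  by have := bt (w - 1); rewrite /H'; split; lia.
have -> : (i + 1 < w) = false by lia.
have [||] := step (2 * w - 1 - (i + 1)); try lia.
have -> : 2 * w - 1 - (i + 1) + 1 = 2 * w - 1 - i by lia.
by rewrite /H'; split; lia.
Qed.

Lemma glue_width : width (glue Q k) = (width Q).*2.
Proof.
by have := column_form_width cf; have := column_form_width glue_column_form; lia.
Qed.

Lemma glue_height : height (glue Q k) = ((height Q).*2 - k)%N.
Proof.
have := column_form_height cf; have := column_form_height glue_column_form.
have [w0 b0 _ _ _] := cf; have := @bottom_le _ _ _ _ cf 0 (w - 1); rewrite b0.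
rewrite /t'; have -> : (2 * w - 1 < w) = false by lia.
have -> : 2 * w - 1 - (2 * w - 1) = 0 by lia.
by rewrite b0 /H'; lia.
Qed.

Lemma glue_area : area (glue Q k) = (area Q).*2.
Proof.
rewrite /area /glue cardfsU.
have -> : Q `&` [fset half_turn (2 * (width Q)%:Z) (2 * (height Q)%:Z - k%:Z) c | c in Q]
    = fset0.
  apply/fsetP=> -[i j]; rewrite !inE; apply/negP => /andP[ijQ /imfsetP[[i' j'] /= ijQ']].
  have [_ _ memQ _ _] := cf; rewrite (column_form_width cf) => -[ei _].
  by move: ijQ ijQ'; rewrite !memQ; lia.
rewrite cardfs0 subn0 card_imfset /=; last exact: inv_inj (half_turnK _ _).
by rewrite addnn.
Qed.

Lemma glue_symmetric : r2_symmetric (glue Q k).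
Proof.
apply/(r2_symmetricP glue_column_form) => i j.
have [w0 b0 _ _ _] := cf.
rewrite !mem_glue_cf /t'; have -> : (2 * w - 1 < w) = false by lia.
have -> : 2 * w - 1 - (2 * w - 1) = 0 by lia.
rewrite b0 subr0.
have -> : 2 * w - 1 - (2 * w - 1 - i) = i by lia.
have -> : H' - 1 - (H' - 1 - j) = j by lia.
by rewrite orbC.
Qed.

Lemma left_half_glue : left_half (glue Q k) = Q.
Proof.
apply/fsetP=> -[i j]; rewrite mem_left_half glue_width doubleK mem_glue_cf.
have [_ _ memQ _ _] := cf; rewrite (column_form_width cf) !memQ /=; lia.
Qed.

End Glue.

Section LeftHalf.
Variables (S : {fset cell}) (w : int) (b t : int -> int).
Hypotheses (cf : column_form S w b t) (symS : r2_symmetric S).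
Hypothesis even_width : ~~ odd (width S).

Let m : int := (width S)./2%:Z.
Let w_m : w = 2 * m.
Proof. by rewrite /m -(column_form_width cf); lia. Qed.
Let m_gt0 : 0 < m. Proof. by have [] := cf; lia. Qed.

Lemma left_half_column_form : column_form (left_half S) m b t.
Proof.
have [w0 b0 memS bt step] := cf; split=> //.
- by move=> i j; rewrite mem_left_half memS -/m [(_, _).1]/=; lia.
- by move=> i im; apply: bt; lia.
by move=> i i0 im; apply: step; lia.
Qed.

(* The symmetry exchanges the two middle columns m - 1 and m. *)
Let sym_bottom : b m = t (w - 1) - t (m - 1).
Proof.
have [w0 b0 memS bt step] := cf.
have turn := (r2_symmetricP cf).1 symS.
have h1 : (m, b m) \in S by rewrite memS; have := bt m; lia.
have h2 : (m - 1, t (m - 1)) \in S by rewrite memS; have := bt (m - 1); lia.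
have := turn _ _ h1; have := turn _ _ h2.
have -> : w - 1 - (m - 1) = m by lia.
have -> : w - 1 - m = m - 1 by lia.
by rewrite !memS; lia.
Qed.

(** By symmetry, the difference of heights considered here is t(m-1) - b(m) + 1,
    the number of rows common to the middle columns m - 1 and m. *)
Lemma overlap_bounds :
  (0 < (height (left_half S)).*2 - height S <= right_height (left_half S))%N.
Proof.
have cfl := left_half_column_form.
have := column_form_height cf; have := column_form_height cfl.
have := column_form_right_height cfl.
have := @bottom_le_next _ _ _ _ cf (m - 1); have := @next_bottom_le_top _ _ _ _ cf (m - 1).
have -> : m - 1 + 1 = m by lia.
by lia.
Qed.

Lemma glue_left_half :
  glue (left_half S) ((height (left_half S)).*2 - height S)%N = S.
Proof.
have cfl := left_half_column_form; have [w0 b0 memS bt step] := cf.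
have turn := (r2_symmetricP cf).1 symS.
have turnE (i j : int) : ((w - 1 - i, t (w - 1) - j) \in S) = ((i, j) \in S).
  apply/idP/idP=> [/turn|]; last exact: turn.
  by congr (_ \in S); congr pair; lia.
apply/fsetP=> -[i j]; rewrite mem_glue /half_turn /=.
have -> : (2 * (width (left_half S))%:Z - 1 - i, 2 * (height (left_half S))%:Z -
    ((height (left_half S)).*2 - height S)%N%:Z - 1 - j) = (w - 1 - i, t (w - 1) - j).
  have o := overlap_bounds; have h := column_form_height cf.
  by have h' := column_form_width cfl; congr pair; lia.
by rewrite !mem_left_half turnE -/m -andb_orr memS ![(_, _).1]/=; lia.
Qed.

End LeftHalf.

(** * Summation *)

Definition normal_parallelogram (n : nat) : set {fset cell} :=
  [set S | [/\ parallelogram S, normalized S & area S = n]]%classic.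

Definition symmetric_even_parallelogram (n : nat) : set {fset cell} :=
  [set S | [/\ parallelogram S, normalized S & area S = n]
             /\ (r2_symmetric S /\ ~~ odd (width S))]%classic.

Lemma finite_normal_parallelogram n : finite_set (normal_parallelogram n).
Proof.
pose side := iota 0 n.
pose box := [fset ((i%:Z, j%:Z) : cell) | i in side, j in side].
apply: (@finite_subfset _ (fpowerset box)) => S [pS nS aS] /=.
have [w [b [t cf]]] := parallelogram_column_form pS nS.
rewrite fpowersetE; apply/fsubsetP => -[i j] ijS.
have ji := column_form_box cf ijS; have [_ _ memS _ _] := cf; rewrite memS in ijS.
have hw := column_form_width cf; have ww := width_le_area cf.
have hh := column_form_height cf; have wh := height_le_area cf.
apply/imfset2P; exists `|i|%N; first by rewrite /= mem_iota; lia.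
exists `|j|%N; first by rewrite /= mem_iota; lia.
by congr pair; lia.
Qed.

Lemma finite_symmetric_even_parallelogram n :
  finite_set (symmetric_even_parallelogram n).
Proof.
by apply: sub_finite_set (finite_normal_parallelogram n) => S [].
Qed.

Lemma symmetric_even_area n S :
  symmetric_even_parallelogram n S -> n = (area (left_half S)).*2.
Proof.
move=> [[pS nS <-] [symS evenS]].
have [w [b [t cf]]] := parallelogram_column_form pS nS.
have cfl := left_half_column_form cf evenS.
rewrite -[in LHS](glue_left_half cf symS evenS) (glue_area cfl) //.
exact: overlap_bounds cf symS evenS.
Qed.

(** The bijection between symmetric polyominoes of area 2m and pairs (Q, k). *)
Lemma symmetric_even_enum m :
  perm_eq (fset_set (symmetric_even_parallelogram m.*2))
    [seq glue Q k | Q <- fset_set (normal_parallelogram m),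
                    k <- index_iota 1 (right_height Q).+1].
Proof.
have memP (Q : {fset cell}) : Q \in fset_set (normal_parallelogram m) ->
    area Q = m /\ exists w b t, column_form Q w b t.
  rewrite in_fset_set; last exact: finite_normal_parallelogram.
  by rewrite inE => -[pQ nQ aQ]; split=> //; apply: parallelogram_column_form.
apply: uniq_perm; first exact: fset_uniq.
  apply: allpairs_uniq_dep; first exact: fset_uniq.
    by move=> Q _; apply: iota_uniq.
  (* Q is the left half of the glued polyomino, and the height 2H - k, with
     k at most H, then determines k. *)
  move=> _ _ /allpairsPdep[Q [k [QP kQ ->]]] /allpairsPdep[Q' [k' [QP' kQ' ->]]] /=.
  have [_ [w [b [t cf]]]] := memP _ QP; have [_ [w' [b' [t' cf']]]] := memP _ QP'.
  rewrite !mem_index_iota !ltnS in kQ kQ' => eqg.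
  have eQ : Q = Q' by rewrite -(left_half_glue cf kQ) eqg (left_half_glue cf' kQ').
  subst Q'; congr existT.
  have := glue_height cf kQ; rewrite eqg (glue_height cf' kQ').
  have := right_height_le cf; lia.
move=> S; apply/idP/allpairsPdep.
  rewrite in_fset_set; last exact: finite_symmetric_even_parallelogram.
  rewrite inE => symS; have aS := symmetric_even_area symS.
  have [[pS nS _] [rS evenS]] := symS.
  have [w [b [t cf]]] := parallelogram_column_form pS nS.
  have cfl := left_half_column_form cf evenS.
  exists (left_half S), ((height (left_half S)).*2 - height S)%N; split.
  - rewrite in_fset_set; last exact: finite_normal_parallelogram.
    rewrite inE; split; last exact: double_inj.
      exact: column_form_parallelogram cfl.
    exact: column_form_normalized cfl.
  - by rewrite mem_index_iota ltnS; apply: overlap_bounds cf rS evenS.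
  - by rewrite (glue_left_half cf).
move=> [Q [k [QP kQ ->]]]; have [aQ [w [b [t cf]]]] := memP _ QP.
rewrite mem_index_iota ltnS in kQ; have cfg := glue_column_form cf kQ.
rewrite in_fset_set; last exact: finite_symmetric_even_parallelogram.
rewrite inE; split; split.
- exact: column_form_parallelogram cfg.
- exact: column_form_normalized cfg.
- by rewrite (glue_area cf kQ) aQ.
- exact: glue_symmetric cf kQ.
- by rewrite (glue_width cf kQ) odd_double.
Qed.

Lemma PP_at_sum a b c m :
  PP_at a b c m = \sum_(Q <- fset_set (normal_parallelogram m))
    a ^+ right_height Q * b ^+ width Q * c ^+ height Q.
Proof.
rewrite /PP_at /PP fsbig_finite; last exact: finite_normal_parallelogram.
rewrite rmorph_sum; apply: eq_bigr => Q _.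
by rewrite !rmorphM !rmorphXn /= /Pv /Px /Py !mmapX !mmap1U.
Qed.

Lemma R2e_double_sum m :
  Qxy_of (R2e m.*2) = \sum_(Q <- fset_set (normal_parallelogram m))
    \sum_(1 <= k < (right_height Q).+1)
      x_ ^+ (width Q).*2 * y_ ^+ ((height Q).*2 - k).
Proof.
rewrite /R2e fsbig_finite; last exact: finite_symmetric_even_parallelogram.
rewrite (perm_big _ (symmetric_even_enum m)) big_allpairs_dep /Qxy_of rmorph_sum.
apply: eq_big_seq => Q; rewrite in_fset_set; last exact: finite_normal_parallelogram.
rewrite inE => -[pQ nQ _]; have [w [b [t cf]]] := parallelogram_column_form pQ nQ.
rewrite rmorph_sum; apply: eq_big_seq => k; rewrite mem_index_iota ltnS => kQ.
by rewrite (glue_width cf kQ) (glue_height cf kQ) rmorphM !rmorphXn.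
Qed.

Lemma R2e_odd n : odd n -> R2e n = 0.
Proof.
move=> odd_n; rewrite /R2e fsbig1 // => S symS.
by move: odd_n; rewrite (symmetric_even_area symS) odd_double.
Qed.

Lemma geometric_overlaps (F : fieldType) (y : F) (h N : nat) :
  y != 0 -> 1 - y != 0 -> (h <= N)%N ->
  \sum_(1 <= k < h.+1) y ^+ (N - k) = (y^-1 ^+ h - 1) * y ^+ N / (1 - y).
Proof.
move=> y0 y1; elim: h => [|h IHh] hN; first by rewrite big_geq // expr0 subrr !mul0r.
rewrite big_nat_recr //= IHh; last exact: ltnW.
have -> : y ^+ N = y ^+ (N - h.+1) * y ^+ h.+1 by rewrite -exprD subnK.
have yh : y ^+ h != 0 by rewrite expf_neq0.
by rewrite !exprVn exprS; field; rewrite y0 y1 yh.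
Qed.

Lemma overlap_weights (F : fieldType) (x y : F) (w h H : nat) :
  y != 0 -> 1 - y != 0 -> (h <= H)%N ->
  \sum_(1 <= k < h.+1) x ^+ w.*2 * y ^+ (H.*2 - k) =
  1 / (1 - y) * (y^-1 ^+ h * (x ^+ 2) ^+ w * (y ^+ 2) ^+ H
                 - 1 ^+ h * (x ^+ 2) ^+ w * (y ^+ 2) ^+ H).
Proof.
move=> y0 y1 hH; rewrite -mulr_sumr geometric_overlaps //; last by lia.
by rewrite -!exprM !mul2n expr1n; ring.
Qed.

(** * The field of fractions *)

Lemma y_neq0 : y_ != 0.
Proof.
rewrite /y_ /Qxy_of tofrac_eq0; apply/eqP => /(congr1 (meval (fun=> 1))).
by rewrite mevalXU meval0.
Qed.

Lemma y_neq1 : 1 - y_ != 0.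
Proof.
rewrite subr_eq0 /y_ /Qxy_of -tofrac1 tofrac_eq.
apply/eqP => /(congr1 (meval (fun=> 0))).
by rewrite mevalXU meval1.
Qed.

Theorem proposition4 :
  forall n : nat,
    Qxy_of (R2e n) =
      1 / (1 - y_) *
        (subst_q2 (PP_at y_^-1 (x_ ^+ 2) (y_ ^+ 2)) n
         - subst_q2 (PP_at 1 (x_ ^+ 2) (y_ ^+ 2)) n).
Proof.
move=> n; rewrite /subst_q2; have [odd_n|even_n] := boolP (odd n).
  rewrite R2e_odd // /Qxy_of tofrac0; apply/esym.
  have zero (F : fieldType) (a : F) : a * (0 - 0) = 0 by rewrite subr0 mulr0.
  exact: zero.
rewrite -[in LHS](odd_double_half n) (negbTE even_n) add0n R2e_double_sum !PP_at_sum.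
rewrite -sumrB mulr_sumr; apply: eq_big_seq => Q.
rewrite in_fset_set; last exact: finite_normal_parallelogram.
rewrite inE => -[pQ nQ _]; have [w [b [t cf]]] := parallelogram_column_form pQ nQ.
exact: overlap_weights y_neq0 y_neq1 (right_height_le cf).
Qed.
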